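(* Fix an integer $k\ge 2$. Consider a finite system of linear equations in finitely many real variables in which every equation is of one of the following two types: $$x_i=\pm 1,$$ $$\pm x_{i_1}\pm x_{i_2}\pm\cdots\pm x_{i_{l+1}}=0,$$ where $l$ is a non-negative integer with $l\le k$ (both $l$ and the signs may depend on the equation). Assume that this system is solvable, and let $n$ be the rank of the system. Then there exists a rational solution of the system such that $|x_j|\le k^{n-1}$ for each variable $x_j$. The bound is sharp: for every integer $k\ge 2$ and every integer $n\ge 1$ there is a solvable system of this form, of rank $n$, such that every solution has some variable $x_j$ with $|x_j|= k^{n-1}$ and all variables of absolute value at most $k^{n-1}$.
   Context: In equations of the second type the indices $i_1,\ldots,i_{l+1}$ need not be distinct, so that for example $kx_i-x_j=0$ is an equation of the second type (with $l=k$). Solvable means having a real solution. The rank of the system is the rank of its coefficient matrix. *)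

(* Defs.v *)
From HB Require Import structures.
From mathcomp Require Import all_boot all_order all_algebra.
From mathcomp Require Import reals.

Set Implicit Arguments.
Unset Strict Implicit.
Unset Printing Implicit Defensive.

Import Order.TTheory GRing.Theory Num.Theory.
Local Open Scope ring_scope.

(* [UnitEq b i] is x_i = (-1)^b.
   [SumEq hl t] is the equation whose l + 1 signed terms are listed in t, the
   pair (b, i) standing for (-1)^b x_i; an index may occur several times in t. *)
Inductive equation (k m : nat) : Type :=
  | UnitEq of bool & 'I_m
  | SumEq (l : nat) of (l <= k)%N & l.+1.-tuple (bool * 'I_m).

Section Systems.
Variables (R : realType) (k m : nat).

Definition holds (e : equation k m) (x : 'I_m -> R) : Prop :=
  match e with
  | UnitEq b i => x i = (-1) ^+ b
  | SumEq _ _ t => \sum_(p <- t) (-1) ^+ p.1 * x p.2 = 0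
  end.

Definition coef (e : equation k m) (j : 'I_m) : R :=
  match e with
  | UnitEq _ i => (i == j)%:R
  | SumEq _ _ t => \sum_(p <- t | p.2 == j) (-1) ^+ p.1
  end.

Variable r : nat.
Implicit Type S : 'I_r -> equation k m.

Definition solution S (x : 'I_m -> R) : Prop := forall i, holds (S i) x.

Definition coef_mx S : 'M[R]_(r, m) := \matrix_(i, j) coef (S i) j.

End Systems.

Definition solvable (R : realType) k m r (S : 'I_r -> equation k m) : Prop :=
  exists x : 'I_m -> R, solution S x.

Definition sysrank (R : realType) k m r (S : 'I_r -> equation k m) : nat :=
  \rank (coef_mx R S).

(* Main.v *)
Require Import Defs.
From mathcomp Require Import all_boot all_order all_algebra.
From mathcomp Require Import reals.
From mathcomp Require Import boolp.
From mathcomp Require Import zify ring lra.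

Set Implicit Arguments.
Unset Strict Implicit.
Unset Printing Implicit Defensive.

Import Order.TTheory GRing.Theory Num.Theory.
Local Open Scope ring_scope.

(** The bound.  Among the solutions, choose [y] whose support has linearly
    independent columns of coefficients ([basic_solution],
    [independent_columns]).  On its support, of size [s], [y] is the only
    solution of a nonsingular integer system [A y = b] of [s] equations of the
    given system, and [s] is at most the rank.  By Cramer's rule
    [y_j = det D / det A], where [D] is [A] with column [j] replaced by [b].
    This is rational, and [det A] is a nonzero integer, so it suffices to show
    [|det D| <= k ^ (s - 1)].

    Bounding [det D] by the Euclidean norms of its rows is too weak, since the
    row of [k x_i = x_j] has norm [sqrt (k^2 + 1)].  The right size of a row is
    the largest absolute value of a sum of some of its entries: the determinant
    is at most the product of these sizes ([det_le_subset_sums]).  Here is why a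
    row of [D] has size at most [k].  Changing the signs of the columns replaces
    [y] by [|y|], which is positive on the support.  Then each equation reads
    [sum_l a_l |y_l| - b = 0], an integer relation between positive numbers, so
    unless it is trivial its coefficients have both signs; since their absolute
    values add up to at most [k + 1], those of one sign add up to at most [k]
    ([subset_sum_le]).  For an equation [x_i = +-1] the same argument with total
    [2] gives size [1].  At least one equation of this kind is among the [s]
    chosen ones, because otherwise [b = 0] and [y = 0].  Hence the product of
    the sizes is at most [k ^ (s - 1)].

    Sharpness.  The system [x_0 = 1], [x_i = k x_(i-1)] for [0 < i < n] has
    rank [n] and the single solution [x_i = k ^ i]. *)

(** * Determinants and subset sums of rows *)

(** The numbers [c u], together with [0], lie in an interval [[-q, p]] of length
    at most [W].  Splitting the sum by the sign of [a j] gives at most [p] times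
    a subset sum of [a], plus [q] times minus another one. *)
Lemma linear_form_bound (R : realDomainType) (T : finType) (a c : T -> R) (w W : R) :
  0 <= W ->
  (forall J : {set T}, `|\sum_(j in J) a j| <= w) ->
  (forall u, `|c u| <= W) -> (forall u v, `|c u - c v| <= W) ->
  `|\sum_j a j * c j| <= w * W.
Proof.
move=> W0 aw.
have w0 : 0 <= w by have := aw set0; rewrite big_set0 normr0.
wlog suff half : c / (forall u, `|c u| <= W) -> (forall u v, `|c u - c v| <= W) ->
    \sum_j a j * c j <= w * W => [cW cdW|].
  rewrite ler_norml half // andbT lerNl -sumrN.
  rewrite (eq_bigr (fun j => a j * - c j)) => [|j _]; last by rewrite mulrN.
  by apply: half => [u|u v]; rewrite ?normrN // -opprD normrN.
move=> cW cdW.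
have [p [q [p0 q0 pqW cp cq]]] : exists p q : R, [/\ 0 <= p, 0 <= q, p + q <= W,
      forall u, c u <= p & forall u, - q <= c u].
  have [u0|T0] := pickP (fun _ : T => true); last first.
    by exists 0, 0; split; rewrite ?addr0 // => u; have := T0 u.
  move=> _.
  have [u _ umax] := Order.TotalTheory.arg_maxP c (isT : predT u0).
  have [v _ vmin] := Order.TotalTheory.arg_minP c (isT : predT u0).
  exists (Num.max 0 (c u)), (Num.max 0 (- c v)); split.
  - by rewrite le_max lexx.
  - by rewrite le_max lexx.
  - have := cdW u v; have := cW u; have := cW v; rewrite !ler_norml.
    by rewrite /Num.max; case: ifP => _; case: ifP => _; lra.
  - by move=> t; rewrite le_max (umax t isT : c t <= c u) orbT.
  - by move=> t; rewrite lerNl le_max lerN2 (vmin t isT : c v <= c t) orbT.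
have bound : \sum_j a j * c j <= \sum_j (if 0 < a j then p * a j else - q * a j).
  apply: ler_sum => j _; case: ltP => aj; have := cp j; have := cq j => h1 h2.
    by rewrite mulrC ler_wpM2r // ltW.
  by rewrite mulrC ler_wnM2r.
apply: le_trans bound _; rewrite (bigID (fun j => 0 < a j)) /=.
rewrite (eq_bigr (fun j => p * a j)) => [|j ->] //; rewrite -mulr_sumr.
rewrite addrC (eq_bigr (fun j => - q * a j)) => [|j /negPf ->] //; rewrite -mulr_sumr.
have := aw [set j | 0 < a j]; have := aw [set j | ~~ (0 < a j)].
under eq_bigl do rewrite inE.
under [in X in _ -> X -> _]eq_bigl do rewrite inE.
rewrite !ler_norml => /andP[N1 N2] /andP[P1 P2].
apply: le_trans (_ : w * (p + q) <= _); last by rewrite ler_wpM2l.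
have := ler_wpM2l p0 P2; have := ler_wpM2l q0 N1; lra.
Qed.

Lemma det_add_col (R : comNzRingType) n (A : 'M[R]_n) (u v : 'I_n) : u != v ->
  \det (\matrix_(i, j) (A i j + (j == v)%:R * A i u)) = \det A.
Proof.
move=> uv; set B := \matrix_(i, j) _.
pose D := \matrix_(i, j) if i == v then A j u else A j i.
rewrite -(det_tr B) (@determinant_multilinear _ _ B^T A^T D v 1 1).
- rewrite !mul1r det_tr [\det D](@determinant_alternate _ _ _ u v) ?addr0 //.
  by move=> j; rewrite !mxE (negPf uv) eqxx.
- by apply/rowP => j; rewrite !mxE eqxx !mul1r.
- by apply/matrixP => i j; rewrite !mxE eq_sym (negPf (neq_lift _ _)) mul0r addr0.
- by apply/matrixP => i j; rewrite !mxE eq_sym (negPf (neq_lift _ _)) mul0r addr0.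
Qed.

(** Expand along the first row and apply [linear_form_bound] to the cofactors.
    A cofactor is a smaller determinant whose row subset sums are among those of
    the given rows.  The difference of the cofactors [u] and [v] is the
    determinant obtained by putting [e_u - e_v] in the first row; adding column
    [u] to column [v] turns that row into [e_u], and expanding leaves a
    determinant in which columns [u] and [v] have been merged into their sum, so
    its row subset sums are again subset sums of the given rows. *)
Lemma det_le_subset_sums (R : realDomainType) n (A : 'M[R]_n) (w : 'I_n -> R) :
  (forall i (J : {set 'I_n}), `|\sum_(j in J) A i j| <= w i) ->
  `|\det A| <= \prod_i w i.
Proof.
elim: n A w => [|n IHn] A w Aw; first by rewrite det_mx00 big_ord0 normr1.
have w0 i : 0 <= w i by have := Aw i set0; rewrite big_set0 normr0.
have cofE (B : 'M[R]_n.+1) u : `|cofactor B ord0 u| = `|\det (row' ord0 (col' u B))|.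
  by rewrite /cofactor normrM normrX normrN1 expr1n mul1r.
rewrite (expand_det_row _ ord0) [X in _ <= X]big_ord_recl.
apply: linear_form_bound => //= [|u|u v]; first exact: prodr_ge0.
  rewrite cofE; apply: IHn => i J.
  under eq_bigr do rewrite !mxE.
  rewrite -(big_imset (fun j => A (lift ord0 i) j)) //=.
  by move=> ? ? _ _; apply: lift_inj.
have [->|uv] := eqVneq u v; first by rewrite subrr normr0 prodr_ge0.
pose B := \matrix_(i, j) if i == ord0 then (j == u)%:R - (j == v)%:R else A i j.
have cofB j : cofactor B ord0 j = cofactor A ord0 j.
  rewrite /cofactor; congr (_ * \det _); apply/matrixP => i l.
  by rewrite !mxE eq_sym (negPf (neq_lift _ _)).
have -> : cofactor A ord0 u - cofactor A ord0 v = \det B.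
  rewrite (expand_det_row _ ord0) (bigD1 u) //= (bigD1 v) 1?eq_sym //=.
  rewrite big1 => [|j /andP[ju jv]]; last first.
    by rewrite !mxE eqxx (negPf ju) (negPf jv) subrr mul0r.
  rewrite !cofB !mxE !eqxx (eq_sym v) (negPf uv) /=; ring.
rewrite -(det_add_col B uv); set D := \matrix_(i, j) _.
have -> : \det D = cofactor D ord0 u.
  rewrite (expand_det_row _ ord0) (bigD1 u) //= big1 => [|j ju].
    by rewrite !mxE !eqxx (negPf uv) /=; ring.
  rewrite !mxE !eqxx (negPf ju) (negPf uv).
  by case: (j == v) => /=; ring.
rewrite cofE; apply: IHn => i J.
(* Entry j0 of the smaller matrix is the merged column u + v, so a subset
   containing j0 comes from one containing both u and v. *)
have [j0 vE|] := unliftP u v; last by move=> e; rewrite e eqxx in uv.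
rewrite (eq_bigr (fun j => A (lift ord0 i) (lift u j)
                         + (j == j0)%:R * A (lift ord0 i) u)); last first.
  by move=> j _; rewrite !mxE vE (inj_eq (@lift_inj _ _)).
rewrite big_split /= -(big_imset (fun j => A (lift ord0 i) j)) /=; last first.
  by move=> ? ? _ _; apply: lift_inj.
have [j0J|j0J] := boolP (j0 \in J).
  rewrite [X in _ + X](bigD1 j0) //= eqxx mul1r [X in _ + (_ + X)]big1; last first.
    by move=> j /andP[_ /negPf->]; rewrite mul0r.
  rewrite addr0 addrC -big_setU1 //=.
  by apply/imsetP => -[j _ /eqP]; rewrite (negPf (neq_lift _ _)).
rewrite [X in _ + X]big1 ?addr0 // => j jJ.
by case: eqP => [e|_]; [rewrite -e jJ in j0J | rewrite mul0r].
Qed.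

(** * Integer relations between positive numbers *)

(** The numbers [a t] and [- c] are the coefficients of a relation between the
    positive numbers [z t] and [1]; the flag [d] says whether [- c] belongs to
    the subset.  By symmetry only the upper bound matters.  A negative
    coefficient takes at least [1] out of the total [w + 1], leaving at most [w]
    for a subset sum; if no coefficient is negative, the relation forces all of
    them to vanish. *)
Lemma subset_sum_le (R : realDomainType) (T : finType) (a : T -> int) (c : int)
    (z : T -> R) (w : nat) :
  (forall t, 0 < z t) -> \sum_t (a t)%:~R * z t = c%:~R ->
  \sum_t `|a t| + `|c| <= w%:Z + 1 ->
  forall (J : {set T}) (d : bool), `|\sum_(t in J) a t - d%:R * c| <= w%:Z.
Proof.
move=> z0 + + J d.
wlog suff half : a c / \sum_t (a t)%:~R * z t = c%:~R ->
    \sum_t `|a t| + `|c| <= w%:Z + 1 ->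
    \sum_(t in J) a t - d%:R * c <= w%:Z => [ac acw|].
  rewrite ler_norml half // andbT lerNl opprB addrC -sumrN -[_ * c]opprK -mulrN.
  apply: (half (fun t => - a t)).
    under eq_bigr do rewrite mulrNz mulNr.
    by rewrite sumrN ac mulrNz.
  by under eq_bigr do rewrite normrN; rewrite normrN.
move=> ac acw.
have aJ (P : pred T) : (forall t, ~~ P t -> a t <= 0) ->
    \sum_(t in J) a t <= \sum_(t | P t) `|a t|.
  move=> Pa; rewrite [leLHS]big_mkcond [leRHS]big_mkcond; apply: ler_sum => t _.
  have := Pa t; case: (P t) => /= h; case: ifP => // _; rewrite ?ler_norm //.
  exact: h.
have [/existsP[t0 at0]|/existsPn apos] := boolP [exists t, a t < 0].
  have le1 : \sum_(t in J) a t <= \sum_(t | t != t0) `|a t|.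
    by apply: aJ => t; rewrite negbK => /eqP->; apply: ltW.
  move: acw le1; rewrite (bigD1 t0) //= ltr0_norm //.
  move: (\sum_(t in J) a t) (\sum_(t | _) _) (a t0) at0 => sJ sT a0 a00.
  have := ler_norm (- c); have := normr_ge0 c; rewrite normrN.
  by case: d; rewrite /= ?mul1r ?mul0r; lia.
have {}apos t : 0 <= a t by rewrite leNgt apos.
have le1 : \sum_(t in J) a t <= \sum_t `|a t| by apply: aJ.
have [c0|c0] := ltP 0 c.
  move: acw le1; rewrite (gtr0_norm c0).
  move: (\sum_(t in J) a t) (\sum_t _) => sJ sT.
  by case: d; rewrite /= ?mul1r ?mul0r; lia.
have az0 t : 0 <= (a t)%:~R * z t by rewrite mulr_ge0 ?ler0z // ltW.
have sum0 : \sum_t (a t)%:~R * z t = 0.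
  by apply/eqP; rewrite eq_le sumr_ge0 // andbT ac lerz0.
have a0 t : a t = 0.
  have /eqP := @psumr_eq0P _ _ xpredT _ (fun t _ => az0 t) sum0 t isT.
  by rewrite mulf_eq0 (gt_eqF (z0 t)) orbF intr_eq0 => /eqP.
have -> : c = 0 by apply/eqP; rewrite -(intr_eq0 R) -ac sum0.
by rewrite mulr0 subr0 big1 //.
Qed.

(** * Integer data of an equation *)

Definition icoef k m (e : equation k m) (j : 'I_m) : int :=
  match e with
  | UnitEq _ i => (i == j)%:R
  | SumEq _ _ t => \sum_(p <- t | p.2 == j) (-1) ^+ p.1
  end.

Definition rhs k m (e : equation k m) : int :=
  if e is UnitEq b _ then (-1) ^+ b else 0.

(** One less than the largest total size of the coefficients and of the constant
    term, see [l1_weight]. *)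
Definition weight k m (e : equation k m) : nat :=
  if e is UnitEq _ _ then 1%N else k.

Lemma coefE (R : realType) k m (e : equation k m) j : coef R e j = (icoef e j)%:~R.
Proof.
case: e => [b i|l hl t] /=; first by case: (i == j).
by rewrite rmorph_sum; apply: eq_bigr => p _; rewrite /= rmorphXn /= rmorphN.
Qed.

Lemma holdsE (R : realType) k m (e : equation k m) (x : 'I_m -> R) :
  holds e x <-> \sum_j (icoef e j)%:~R * x j = (rhs e)%:~R.
Proof.
case: e => [b i|l hl t] /=.
  rewrite (bigD1 i) //= eqxx mul1r big1 ?addr0 => [|j].
    by rewrite rmorphXn /= rmorphN.
  by rewrite eq_sym => /negPf->; rewrite mul0r.
rewrite (partition_big (fun p => p.2) predT) //=.
rewrite [X in X = _ <-> _](_ : _ =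
  \sum_j (\sum_(p <- t | p.2 == j) (-1) ^+ p.1)%:~R * x j) //.
apply: eq_bigr => j _; rewrite rmorph_sum mulr_suml.
by apply: eq_bigr => p /eqP->; rewrite /= rmorphXn /= rmorphN.
Qed.

Lemma l1_weight k m (e : equation k m) :
  \sum_j `|icoef e j| + `|rhs e| <= (weight e)%:Z + 1.
Proof.
case: e => [b i|l hl t] /=.
  rewrite (bigD1 i) //= eqxx big1 => [|j].
    by rewrite normrX normrN1 expr1n.
  by rewrite eq_sym => /negPf->.
rewrite normr0 addr0.
apply: (@le_trans _ _ (\sum_(j < m) \sum_(p <- t | p.2 == j) (1 : int))).
  apply: ler_sum => j _; apply: le_trans (ler_norm_sum _ _ _) _.
  by apply: ler_sum => p _; rewrite normrX normrN1 expr1n.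
rewrite (_ : \sum_j _ = \sum_(p <- t) 1); last first.
  by rewrite [RHS](partition_big (fun p => p.2) predT).
rewrite big_const_seq count_predT size_tuple.
by rewrite iter_addr_0 natz; lia.
Qed.

(** * Bounds from Cramer's rule *)

(** The cofactors along column [j] do not see the replaced column, so both sides
    are entry [j] of [\adj A *m (A *m y)]. *)
Lemma cramer (R : comNzRingType) n (A : 'M[R]_n) (y : 'cV_n) (j : 'I_n) :
  \det A * y j 0 = \det (\matrix_(i, l) if l == j then (A *m y) i 0 else A i l).
Proof.
rewrite [RHS](expand_det_col _ j).
have -> : \det A * y j 0 = (\adj A *m (A *m y)) j 0.
  by rewrite mulmxA mul_adj_mx mul_scalar_mx mxE.
rewrite mxE; apply: eq_bigr => i _; rewrite mulrC !mxE eqxx; congr (_ * _).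
rewrite /cofactor; congr (_ * \det _); apply/matrixP => p q.
by rewrite !mxE eq_sym (negPf (neq_lift _ _)).
Qed.

(** The signs of [y] are absorbed into the columns of Cramer's numerator before
    the bound by subset sums applies. *)
Lemma cramer_bound (R : realType) n (A : 'M[int]_n) (b : 'I_n -> int)
    (y : 'I_n -> R) (w : 'I_n -> nat) :
  \det A != 0 ->
  (forall l, y l != 0) ->
  (forall i, \sum_l (A i l)%:~R * y l = (b i)%:~R) ->
  (forall i, \sum_l `|A i l| + `|b i| <= (w i)%:Z + 1) ->
  forall j, exists2 q : rat, ratr q = y j & `|q| <= (\prod_i w i)%:R.
Proof.
move=> detA y0 Ay Aw j.
pose D := \matrix_(i, l) if l == j then b i else A i l.
have detD : (\det A)%:~R * y j = (\det D)%:~R :> R.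
  have := cramer (map_mx intr A) (\col_l y l) j.
  rewrite !det_map_mx !mxE => ->; rewrite -det_map_mx; congr (\det _).
  apply/matrixP => i l; rewrite !mxE; case: eqP => // _.
  by rewrite [RHS](esym (Ay i)); apply: eq_bigr => p _; rewrite !mxE.
exists ((\det D)%:~R / (\det A)%:~R).
  by rewrite fmorph_div /= !ratr_int -detD mulrC mulKf // intr_eq0.
(* Integrality: the denominator only helps. *)
have A1 : 1 <= `|\det A| by move: detA; rewrite -normr_gt0; lia.
rewrite normf_div ler_pdivrMr; last by rewrite normr_gt0 intr_eq0.
rewrite -!intr_norm -[(\prod_i w i)%:R]/((\prod_i w i)%:Z%:~R) -intrM ler_int.
apply: le_trans (_ : (\prod_i w i)%:Z <= _); last by rewrite ler_peMr.
(* Sign -1 in column j: it holds b, which enters the relation as - b. *)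
pose d := \row_l if l == j then -1 else sgz (y l).
have -> : `|\det D| = `|\det (D *m diag_mx d)|.
  rewrite det_mulmx det_diag normrM normr_prod [X in _ * X]big1 ?mulr1 // => l _.
  rewrite mxE; case: eqP => // _.
  by case: sgzP (y0 l) => //; rewrite eqxx.
rewrite (_ : (\prod_i w i)%:Z = \prod_i (w i)%:Z); last first.
  by rewrite -[LHS]natz natr_prod; apply: eq_bigr => i _; rewrite natz.
apply: det_le_subset_sums => i J; rewrite mul_mx_diag.
pose a l := A i l * sgz (y l).
have -> : \sum_(l in J) (\matrix_(p, q) (D p q * d 0 q)) i l
    = \sum_(l in J :\ j) a l - (j \in J)%:R * b i.
  rewrite (eq_bigr (fun l => if l == j then - b i else a l)); last first.
    by move=> l _; rewrite !mxE; case: eqP => // _; rewrite mulrN1.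
  have [jJ|jJ] := boolP (j \in J).
    rewrite (big_setD1 j) //= eqxx mul1r addrC; congr (_ + _).
    by apply: eq_bigr => l; rewrite !inE => /andP[/negPf-> _].
  rewrite mul0r subr0; apply: eq_big => l.
    by rewrite !inE; case: eqP => // ->; rewrite (negPf jJ).
  by case: eqP => // -> /idPn; rewrite jJ.
apply: (@subset_sum_le R _ a (b i) (fun l => `|y l|)).
- by move=> l; rewrite normr_gt0.
- rewrite -Ay; apply: eq_bigr => l _.
  by rewrite rmorphM /= -mulrA -sgrEz -numEsg.
- apply: le_trans (Aw i); rewrite lerD2r; apply: ler_sum => l _.
  by rewrite normrM; case: sgzP; rewrite ?normrN ?normr1 ?normr0 ?mulr1 ?mulr0.
Qed.

(** * Solutions with independent columns *)

(** A solution of minimal support works: subtracting a multiple of a vector of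
    the kernel with support inside that of [x] cancels one more entry. *)
Lemma basic_solution (F : fieldType) r m (C : 'M[F]_(r, m)) (x : 'cV_m) :
  exists y : 'cV_m, C *m y = C *m x /\
    forall v : 'cV_m, C *m v = 0 -> (forall j, y j 0 = 0 -> v j 0 = 0) -> v = 0.
Proof.
have [N] := ubnP #|[set j | x j 0 != 0]|.
elim: N x => // N IHN x; rewrite ltnS => xN.
have [[v [Cv xv v0]]|noV] := EM (exists v : 'cV_m,
    [/\ C *m v = 0, forall j, x j 0 = 0 -> v j 0 = 0 & v <> 0]); last first.
  exists x; split=> // v Cv xv; apply: contrapT => v0.
  by apply: noV; exists v.
have [j0 vj0] : exists j, v j 0 != 0.
  apply: contrapT => nv; apply: v0; apply/colP => j; rewrite mxE.
  by apply/eqP/negPn/negP => vj; apply: nv; exists j.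
pose x' := x - (x j0 0 / v j0 0) *: v.
have Cx' : C *m x' = C *m x by rewrite mulmxBr -scalemxAr Cv scaler0 subr0.
have [|y [Cy yP]] := IHN x'; last by exists y; rewrite Cy.
apply: leq_trans xN; apply: proper_card; apply/properP; split.
  apply/subsetP => j; rewrite !inE; apply: contra => /eqP xj.
  by rewrite !mxE xj (xv j xj) mulr0 subr0.
exists j0; first by rewrite inE; apply: contra vj0 => /eqP/xv->.
by rewrite inE negbK !mxE divfK // subrr.
Qed.

Lemma independent_columns (F : fieldType) r m (C : 'M[F]_(r, m)) (y : 'cV[F]_m) :
  (forall v : 'cV_m, C *m v = 0 -> (forall j, y j 0 = 0 -> v j 0 = 0) -> v = 0) ->
  row_full (colsub (fun l : 'I_#|[set j | y j 0 != 0]| => enum_val l) C).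
Proof.
set Y := [set j | _] => indep; set B := colsub _ C.
pose E : 'M[F]_(m, #|Y|) := \matrix_(j, l) (j == enum_val l)%:R.
have CE : C *m E = B.
  apply/matrixP => i l; rewrite !mxE (bigD1 (enum_val l)) //= !mxE eqxx mulr1.
  by rewrite big1 ?addr0 // => j /negPf jl; rewrite mxE jl mulr0.
rewrite /row_full -mxrank_tr; apply: inj_row_free => v /(congr1 trmx).
rewrite trmx_mul trmxK trmx0 -CE -mulmxA => /indep Ev0.
have {}Ev0 : E *m v^T = 0.
  apply: Ev0 => j yj; rewrite mxE big1 // => l _; rewrite mxE.
  case: eqP => [jl|]; last by rewrite mul0r.
  by have := enum_valP l; rewrite -jl inE yj eqxx.
apply/rowP => l; move/colP: Ev0 => /(_ (enum_val l)).
rewrite !mxE (bigD1 l) //= !mxE eqxx mul1r big1 ?addr0 // => p pl.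
by rewrite !mxE (inj_eq enum_val_inj) eq_sym (negPf pl) mul0r.
Qed.

Lemma solution_mx (R : realType) k m r (S : 'I_r -> equation k m) (x : 'cV[R]_m) :
  solution S (fun j => x j 0) <-> coef_mx R S *m x = \col_i (rhs (S i))%:~R.
Proof.
have E i : (coef_mx R S *m x) i 0 = \sum_j (icoef (S i) j)%:~R * x j 0.
  by rewrite !mxE; apply: eq_bigr => j _; rewrite !mxE coefE.
split=> [Sx|Sx i].
  by apply/colP => i; rewrite E mxE; apply/holdsE/Sx.
by apply/holdsE; rewrite -E Sx mxE.
Qed.

(** * The bounded rational solution *)

Lemma small_rational_solution (R : realType) k (k0 : (0 < k)%N) m r
    (S : 'I_r -> equation k m) :
  solvable R S ->
  exists q : 'I_m -> rat, solution S (fun j => ratr (q j) : R) /\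
    (forall j, `|q j| <= k%:R ^ ((sysrank R S)%:Z - 1)).
Proof.
move=> [x Sx]; have := (solution_mx S (\col_j x j)).1; set C := coef_mx R S => CxE.
have {}CxE : C *m \col_j x j = \col_i (rhs (S i))%:~R.
  by apply: CxE => i; move: (Sx i); congr (holds _); apply/funext => j; rewrite mxE.
have [y [Cy indep]] := basic_solution C (\col_j x j); rewrite CxE in Cy.
have fullB := independent_columns indep.
set Y := [set j | y j 0 != 0] in fullB.
set s := #|Y| in fullB; set B := colsub _ C in fullB.
pose e l : 'I_m := enum_val (l : 'I_#|Y|).
have ye l : y (e l) 0 != 0 by have := enum_valP l; rewrite inE.
pose f := fullrankfun fullB.
pose A : 'M[int]_s := \matrix_(i, l) icoef (S (f i)) (e l).
pose AR : 'M[R]_s := map_mx intr A.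
have AB : AR = rowsub f B.
  by apply/matrixP => i l; rewrite !mxE coefE.
have detA : \det A != 0.
  have : row_full (rowsub f B) by exact: fullrowsub_full.
  by rewrite row_full_unit -AB unitmxE det_map_mx unitfE intr_eq0.
have sn : (s <= sysrank R S)%N.
  have /eqP <- : row_full B := fullB; rewrite -mxrank_tr.
  by rewrite /sysrank -/C -(mxrank_tr C) /B trmx_mxsub mxrankS // rowsub_sub.
pose b (i : 'I_s) := rhs (S (f i)).
have Ay i : \sum_l (A i l)%:~R * y (e l) 0 = (b i)%:~R.
  have /holdsE <- := (solution_mx S y).2 Cy (f i).
  rewrite [RHS](bigID (mem Y)) /= [X in _ + X]big1 ?addr0; last first.
    by move=> j; rewrite inE negbK => /eqP->; rewrite mulr0.
  by rewrite [RHS]big_enum_val; apply: eq_bigr => l _; rewrite !mxE.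
have Aw i : \sum_l `|A i l| + `|b i| <= (weight (S (f i)))%:Z + 1.
  apply: le_trans (l1_weight (S (f i))); rewrite lerD2r.
  rewrite [leRHS](bigID (mem Y)) /= [X in _ <= X + _]big_enum_val /=.
  rewrite [leLHS](eq_bigr (fun l => `|icoef (S (f i)) (e l)|)); last first.
    by move=> l _; rewrite mxE.
  by rewrite lerDl sumr_ge0.
have prodw (l0 : 'I_s) : (\prod_i weight (S (f i)) <= k ^ s.-1)%N.
  (* An equation with nonzero right-hand side has weight 1; this is what saves
     one factor k. *)
  have [i0 bi0] : exists i, b i != 0.
    apply: contrapT => nb; have := ye l0; apply/negP/negPn/eqP.
    have : AR *m (\col_l y (e l) 0) = 0.
      apply/colP => i; rewrite !mxE (eq_bigr (fun l => (A i l)%:~R * y (e l) 0)).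
        2: by move=> l _; rewrite !mxE.
      by apply/eqP; rewrite Ay intr_eq0; apply/negPn/negP => bi; apply: nb; exists i.
    move/(congr1 (mulmx (invmx AR))); rewrite mulKmx ?mulmx0.
      by move/colP/(_ l0); rewrite !mxE.
    by rewrite unitmxE det_map_mx unitfE intr_eq0.
  rewrite (bigD1 i0) //=; have -> : weight (S (f i0)) = 1%N.
    by move: bi0; rewrite /b; case: (S (f i0)).
  rewrite mul1n -[X in (k ^ X.-1)%N]card_ord -(cardC1 i0) -prod_nat_const.
  by apply: leq_prod => i _; case: (S (f i)).
have yq j : exists q : rat, ratr q = y j 0 /\ `|q| <= k%:R ^ ((sysrank R S)%:Z - 1).
  have [/eqP yj|yj] := boolP (y j 0 == 0).
    (* This covers rank 0, where the exponent is -1. *)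
    by exists 0; rewrite rmorph0 yj normr0 exprz_ge0.
  have jY : j \in Y by rewrite inE.
  have [q qy qb] := cramer_bound detA ye Ay Aw (enum_rank_in jY j).
  exists q; split; first by rewrite qy /e enum_rankK_in.
  have s0 : (0 < s)%N by apply/card_gt0P; exists j.
  apply: le_trans qb _.
  have -> : (sysrank R S)%:Z - 1 = (sysrank R S).-1%:Z by lia.
  rewrite -exprnP -natrX ler_nat.
  apply: leq_trans (prodw (enum_rank_in jY j)) _.
  by rewrite leq_pexp2l //; lia.
have [q qP] := choice yq.
exists q; split=> [i|j]; last by have [] := qP j.
have := (solution_mx S y).2 Cy i; congr (holds _); apply/funext => j.
by have [-> _] := qP j.
Qed.

(** * The extremal system *)

Definition chain k n (i : 'I_n.+1) : equation k n.+1 :=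
  if i == ord0 then UnitEq k false ord0 else
  SumEq (leqnn k) [tuple of (true, i) :: nseq k (false, inord i.-1)].

Lemma coef_chain (R : realType) k n (i j : 'I_n.+1) : coef R (chain k i) j =
  if i == ord0 then (j == ord0)%:R else (inord i.-1 == j)%:R * k%:R - (i == j)%:R.
Proof.
rewrite /chain; case: eqP => [_|i0] /=; first by rewrite eq_sym.
rewrite big_cons big_nseq_cond /= expr0 expr1.
case: (inord _ == j); rewrite ?iter_addr_0 ?mul1r ?mul0r.
  by case: (i == j); rewrite ?subr0 // addrC.
by case: (i == j); rewrite ?addr0 ?subr0 // sub0r.
Qed.

Lemma holds_chain (R : realType) k n (i : 'I_n.+1) (x : 'I_n.+1 -> R) :
  holds (chain k i) x <->
  (if i == ord0 then x ord0 = 1 else x i = k%:R * x (inord i.-1)).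
Proof.
rewrite /chain; case: eqP => [_|_] /=; first by rewrite expr0.
rewrite big_cons big_nseq iter_addr_0 /= expr0 expr1 mul1r mulN1r mulr_natl addrC.
by split=> [/subr0_eq|->] //; rewrite subrr.
Qed.

Lemma solution_chain (R : realType) k n (x : 'I_n.+1 -> R) :
  solution (@chain k n) x <-> forall i, x i = k%:R ^+ i.
Proof.
split=> [Sx|xE i].
  suff xk j : (j <= n)%N -> x (inord j) = k%:R ^+ j.
    by move=> i; rewrite -[in LHS](inord_val i) xk // -ltnS.
  elim: j => [_|j IHj jn].
    have /holds_chain /= := Sx ord0.
    by congr (x _ = _); apply: val_inj; rewrite /= inordK.
  have /holds_chain := Sx (inord j.+1).
  rewrite -(inj_eq val_inj) /= !inordK //= => ->.
  by rewrite IHj ?exprS // ltnW.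
apply/holds_chain; case: eqP => [_|/eqP]; first by rewrite xE expr0.
rewrite -(inj_eq val_inj) /= => i0; rewrite !xE -exprS inordK.
  by rewrite prednK // lt0n.
by rewrite (leq_ltn_trans (leq_pred _)).
Qed.

Lemma rank_chain (R : realType) k n : sysrank R (@chain k n) = n.+1.
Proof.
have trig : is_trig_mx (coef_mx R (@chain k n)).
  apply/is_trig_mxP => i j ij; rewrite mxE coef_chain.
  have [_|i0] := eqVneq i ord0.
    by rewrite -(inj_eq val_inj) gtn_eqF //=; apply: leq_ltn_trans ij.
  have -> : (inord i.-1 == j) = false.
    apply: contraTF ij => /eqP <-; rewrite inordK -?leqNgt ?leq_pred //.
    exact: leq_ltn_trans (leq_pred _) _.
  by rewrite (_ : i == j = false) ?mul0r ?subr0 // -(inj_eq val_inj) ltn_eqF.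
apply: mxrank_unit; rewrite unitmxE det_trig // unitfE.
apply/prodf_neq0 => i _; rewrite mxE coef_chain.
have [_|i0] := eqVneq i ord0; first by rewrite oner_eq0.
rewrite eqxx (_ : inord _ == i = false) ?mul0r ?sub0r ?oppr_eq0 ?oner_eq0 //.
move: i0; rewrite -!(inj_eq val_inj) /= -lt0n => i0.
by rewrite inordK ?(leq_ltn_trans (leq_pred _)) // ltn_eqF // ltn_predL.
Qed.

Theorem theorem1p2 (R : realType) (k : nat) (hk : (2 <= k)%N) :
  (forall (m r : nat) (S : 'I_r -> equation k m) (n : nat),
     solvable R S -> sysrank R S = n ->
     exists q : 'I_m -> rat,
       solution S (fun j => ratr (q j) : R) /\
       (forall j, `|q j| <= k%:R ^ (n%:Z - 1)))
  /\
  (forall n : nat, (1 <= n)%N ->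
     exists (m r : nat) (S : 'I_r -> equation k m),
       [/\ solvable R S,
           sysrank R S = n &
           forall x : 'I_m -> R, solution S x ->
             (exists j, `|x j| = k%:R ^ (n%:Z - 1)) /\
             (forall j, `|x j| <= k%:R ^ (n%:Z - 1))]).
Proof.
split=> [m r S _ solS <-|[//|n] _].
  by apply: small_rational_solution => //; apply: ltnW.
exists n.+1, n.+1, (@chain k n); split; first last.
- move=> x /solution_chain xE.
  have -> : n.+1%:Z - 1 = n by lia.
  rewrite -exprnP; split=> [|j].
    by exists ord_max; rewrite xE normrX normr_nat.
  by rewrite xE normrX normr_nat -!natrX ler_nat leq_pexp2l -1?ltnS // ltnW.
- exact: rank_chain.
- by exists (fun i => k%:R ^+ i); apply/solution_chain.
Qed.
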